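(* The central element $\Theta=y_0^2+y_1^2+y_2^2+y_3^2$ of $\widetilde Q$ does not annihilate any point module for $\widetilde Q$. Consequently, $\widetilde B=\widetilde Q/(\Theta,\Theta')$ has no point modules.
   Context: Let $k$ be an algebraically closed field of characteristic not $2$, and let $\alpha_1,\alpha_2,\alpha_3\in k$ satisfy $\alpha_1+\alpha_2+\alpha_3+\alpha_1\alpha_2\alpha_3=0$ and $\{\alpha_1,\alpha_2,\alpha_3\}\cap\{0,1,-1\}=\varnothing$. Let $\widetilde Q$ be the graded $k$-algebra generated by degree-one elements $y_0,y_1,y_2,y_3$ subject to the six relations $y_0y_i-y_iy_0=\alpha_i(y_jy_k-y_ky_j)$, $y_0y_i+y_iy_0=y_jy_k+y_ky_j$, $(i,j,k)$ running over the cyclic permutations of $(1,2,3)$. The elements $\Theta=y_0^2+y_1^2+y_2^2+y_3^2$ and $\Theta'=y_1^2+\frac{1+\alpha_1}{1-\alpha_2}y_2^2+\frac{1-\alpha_1}{1+\alpha_3}y_3^2$ are central in $\widetilde Q$. A point module for a connected graded algebra $A$ is a graded left $A$-module $M=\bigoplus_{i\ge 0}M_i$ with $M=AM_0$ and $\dim_kM_i=1$ for all $i\ge0$. *)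

(* Defs.v *)
From HB Require Import structures.
From mathcomp Require Import all_boot all_order all_algebra.
From mathcomp Require Import monalg boolp.

Set Implicit Arguments.
Unset Strict Implicit.
Unset Printing Implicit Defensive.

Import GRing.Theory.
Local Open Scope ring_scope.
Local Open Scope quotient_scope.

Section IdealGen.
Variables (k : fieldType) (A : algType k) (S : A -> Prop).

(* Two-sided ideal generated by S: finite sums of a * s * b with s in S. *)
Definition ideal_gen (x : A) : Prop :=
  exists2 t : seq (A * A * A), (forall u, u \in t -> S u.1.2) &
    x = \sum_(u <- t) u.1.1 * u.1.2 * u.2.

Lemma ideal_gen_in x : S x -> ideal_gen x.
Proof.
move=> Sx; exists [:: (1, x, 1)]; first by move=> u /[1!inE] /eqP ->.
by rewrite big_seq1 /= mul1r mulr1.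
Qed.

Lemma ideal_gen0 : ideal_gen 0.
Proof. by exists [::] => //; rewrite big_nil. Qed.

Lemma ideal_genD x y : ideal_gen x -> ideal_gen y -> ideal_gen (x + y).
Proof.
move=> [s Ss ->] [t St ->]; exists (s ++ t); last by rewrite big_cat.
by move=> u; rewrite mem_cat => /orP[/Ss|/St].
Qed.

Lemma ideal_genMl a x : ideal_gen x -> ideal_gen (a * x).
Proof.
move=> [s Ss ->]; exists [seq (a * u.1.1, u.1.2, u.2) | u <- s].
  by move=> _ /mapP[u /Ss Su ->].
rewrite big_map mulr_sumr; apply: eq_bigr => u _ /=; by rewrite !mulrA.
Qed.

Lemma ideal_genMr a x : ideal_gen x -> ideal_gen (x * a).
Proof.
move=> [s Ss ->]; exists [seq (u.1.1, u.1.2, u.2 * a) | u <- s].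
  by move=> _ /mapP[u /Ss Su ->].
rewrite big_map mulr_suml; apply: eq_bigr => u _ /=; by rewrite !mulrA.
Qed.

Lemma ideal_genB x y : ideal_gen x -> ideal_gen y -> ideal_gen (x - y).
Proof.
by move=> Ix Iy; apply: ideal_genD => //; rewrite -mulN1r; apply: ideal_genMl.
Qed.

Lemma ideal_gen_ker (B : nzRingType) (f : {rmorphism A -> B}) :
  (forall s, S s -> f s = 0) -> forall x, ideal_gen x -> f x = 0.
Proof.
move=> fS x [t St ->]; rewrite rmorph_sum big_seq big1 // => u /St Su.
by rewrite !rmorphM /= (fS _ Su) mulr0 mul0r.
Qed.

End IdealGen.

Section AlgQuotient.
Variables (k : fieldType) (A : algType k) (S : A -> Prop).

Definition ideal_pred : pred A := fun x => `[< ideal_gen S x >].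

Lemma ideal_pred_zmod : zmod_closed ideal_pred.
Proof.
split=> [|x y]; rewrite !unfold_in.
  by apply/asboolP; exact: ideal_gen0.
by move=> /asboolP Ix /asboolP Iy; apply/asboolP; exact: ideal_genB.
Qed.

HB.instance Definition _ := GRing.isZmodClosed.Build A ideal_pred ideal_pred_zmod.

Definition ideal_closed : zmodClosed A := GRing.ZmodClosed.clone A ideal_pred _.

(* The properness proof is an index because an algType is a nonzero ring. *)
Definition algquot of ~ ideal_gen S 1 := Quotient.quot ideal_closed.

Variable S1 : ~ ideal_gen S 1.
Local Notation Q := (algquot S1).

HB.instance Definition _ := GRing.Zmodule.copy Q (Quotient.quot ideal_closed).

Definition algpi (x : A) : Q := \pi_(Quotient.quot ideal_closed) x.

Definition alglift (u : Q) : A := repr (u : Quotient.quot ideal_closed).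

Lemma algliftK : cancel alglift algpi.
Proof. exact: reprK. Qed.

Lemma algpi_eq x y : algpi x = algpi y <-> ideal_gen S (x - y).
Proof.
have -> : ideal_gen S (x - y) <-> x - y \in ideal_closed.
  by split=> /asboolP.
by rewrite Quotient.idealrBE; split=> /eqP.
Qed.

Lemma algpi0P x : algpi x = 0 <-> ideal_gen S x.
Proof.
have -> : 0 = algpi 0 by rewrite /algpi raddf0.
by rewrite algpi_eq subr0.
Qed.

Lemma algpiK x : ideal_gen S (alglift (algpi x) - x).
Proof. by apply/algpi_eq; rewrite algliftK. Qed.

Lemma algpiD : {morph algpi : x y / x + y}.
Proof. exact: raddfD. Qed.

Lemma algpi_is_zmod_morphism : zmod_morphism algpi.
Proof. exact: raddfB. Qed.

(* Locked so that unification never unfolds the operations of the quotient. *)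
Definition algquot_one : Q := locked (algpi 1).
Definition algquot_mul : Q -> Q -> Q :=
  locked (fun u v => algpi (alglift u * alglift v)).
Definition algquot_scale : k -> Q -> Q :=
  locked (fun c u => algpi (c *: alglift u)).

Lemma algpi1 : algpi 1 = algquot_one.
Proof. by rewrite /algquot_one -lock. Qed.

Lemma algpiM x y : algpi (x * y) = algquot_mul (algpi x) (algpi y).
Proof.
rewrite /algquot_mul -lock; apply/esym/algpi_eq.
set x' := alglift _; set y' := alglift _.
have -> : x' * y' - x * y = (x' - x) * y' + x * (y' - y).
  by rewrite mulrBl mulrBr addrA subrK.
by apply: ideal_genD; [apply: ideal_genMr|apply: ideal_genMl]; exact: algpiK.
Qed.

Lemma algpiZ c x : algpi (c *: x) = algquot_scale c (algpi x).
Proof.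
rewrite /algquot_scale -lock; apply/esym/algpi_eq; rewrite -scalerBr -mulr_algl.
by apply: ideal_genMl; exact: algpiK.
Qed.

Lemma algquot_mulA : associative algquot_mul.
Proof.
move=> u v w; rewrite -(algliftK u) -(algliftK v) -(algliftK w).
by rewrite -!algpiM mulrA.
Qed.

Lemma algquot_mul1 : left_id algquot_one algquot_mul.
Proof. by move=> u; rewrite -(algliftK u) -algpi1 -algpiM mul1r. Qed.

Lemma algquot_mulr1 : right_id algquot_one algquot_mul.
Proof. by move=> u; rewrite -(algliftK u) -algpi1 -algpiM mulr1. Qed.

Lemma algquot_mulDl : left_distributive algquot_mul +%R.
Proof.
move=> u v w; rewrite -(algliftK u) -(algliftK v) -(algliftK w).
by rewrite -algpiD -!algpiM mulrDl algpiD.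
Qed.

Lemma algquot_mulDr : right_distributive algquot_mul +%R.
Proof.
move=> u v w; rewrite -(algliftK u) -(algliftK v) -(algliftK w).
by rewrite -algpiD -!algpiM mulrDr algpiD.
Qed.

Lemma algquot_one_neq0 : algquot_one != 0.
Proof. by rewrite -algpi1; apply/eqP => /algpi0P. Qed.

HB.instance Definition _ := GRing.Zmodule_isNzRing.Build Q
  algquot_mulA algquot_mul1 algquot_mulr1 algquot_mulDl algquot_mulDr
  algquot_one_neq0.

Lemma algquot_scaleA a b (u : Q) :
  algquot_scale a (algquot_scale b u) = algquot_scale (a * b) u.
Proof. by rewrite -(algliftK u) -!algpiZ scalerA. Qed.

Lemma algquot_scale1 : left_id 1 algquot_scale.
Proof. by move=> u; rewrite -(algliftK u) -algpiZ scale1r. Qed.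

Lemma algquot_scaleDr : right_distributive algquot_scale +%R.
Proof.
move=> a u v; rewrite -(algliftK u) -(algliftK v).
by rewrite -algpiD -!algpiZ scalerDr algpiD.
Qed.

Lemma algquot_scaleDl u : {morph algquot_scale^~ u : a b / a + b}.
Proof. by move=> a b; rewrite -(algliftK u) -!algpiZ scalerDl algpiD. Qed.

HB.instance Definition _ := GRing.Zmodule_isLmodule.Build k Q
  algquot_scaleA algquot_scale1 algquot_scaleDr algquot_scaleDl.

Lemma algquot_scaleAl (c : k) (u v : Q) : c *: (u * v) = (c *: u) * v.
Proof.
change (algquot_scale c (algquot_mul u v) = algquot_mul (algquot_scale c u) v).
by rewrite -(algliftK u) -(algliftK v) -algpiM -!algpiZ -algpiM scalerAl.
Qed.

HB.instance Definition _ := GRing.Lmodule_isLalgebra.Build k Q algquot_scaleAl.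

Lemma algquot_scaleAr (c : k) (u v : Q) : c *: (u * v) = u * (c *: v).
Proof.
change (algquot_scale c (algquot_mul u v) = algquot_mul u (algquot_scale c v)).
by rewrite -(algliftK u) -(algliftK v) -algpiM -!algpiZ -algpiM scalerAr.
Qed.

HB.instance Definition _ := GRing.Lalgebra_isAlgebra.Build k Q algquot_scaleAr.

Lemma algpi_is_monoid_morphism : monoid_morphism algpi.
Proof. by split=> [|x y]; [exact: algpi1|exact: algpiM]. Qed.

HB.instance Definition _ := GRing.isZmodMorphism.Build A Q algpi
  algpi_is_zmod_morphism.
HB.instance Definition _ := GRing.isMonoidMorphism.Build A Q algpi
  algpi_is_monoid_morphism.
HB.instance Definition _ := GRing.isScalable.Build k A Q *:%R algpi algpiZ.

Lemma algquot_fact (B : nzRingType) (f : {rmorphism A -> B}) :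
  (forall s, S s -> f s = 0) ->
  exists g : {rmorphism Q -> B}, forall x, g (algpi x) = f x.
Proof.
move=> fS; pose g (u : Q) := f (alglift u).
have gE x : g (algpi x) = f x.
  apply/eqP; rewrite -subr_eq0 -rmorphB; apply/eqP.
  exact: ideal_gen_ker fS _ (algpiK x).
have gB : zmod_morphism g.
  move=> u v; rewrite -(algliftK u) -(algliftK v).
  by rewrite -[algpi _ - _]rmorphB !gE rmorphB.
have gM : monoid_morphism g.
  split=> [|u v]; first by rewrite -[1]algpi1 gE rmorph1.
  by rewrite -(algliftK u) -(algliftK v) -[_ * _]algpiM !gE rmorphM.
pose gz := GRing.isZmodMorphism.Build Q B g gB.
pose gm := GRing.isMonoidMorphism.Build Q B g gM.
pose G : {rmorphism Q -> B} := HB.pack g gz gm.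
by exists G.
Qed.

(* Image of a grading of A; it is the quotient grading when S consists of
   homogeneous elements. *)
Definition quot_grading (Agr : nat -> A -> Prop) (n : nat) (u : Q) : Prop :=
  exists2 x, Agr n x & u = algpi x.

End AlgQuotient.

Section GradedModule.
Variables (k : fieldType) (A : algType k) (Agr : nat -> A -> Prop).
Variables (M : lmodType A) (Mgr : nat -> M -> Prop).

(* Internal direct sum decomposition of M into the k-subspaces Mgr i, where k
   acts on M through c |-> c%:A, with A_i M_j contained in M_(i+j). *)
Record graded_module : Prop := GradedModule {
  graded_sub0 : forall i, Mgr i 0;
  graded_subD : forall i (c : k) x y,
    Mgr i x -> Mgr i y -> Mgr i (c%:A *: x + y);
  graded_span : forall x, exists n, exists2 v : nat -> M,
    (forall i, Mgr i (v i)) & x = \sum_(i < n) v i;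
  graded_direct : forall n (v : nat -> M), (forall i, Mgr i (v i)) ->
    \sum_(i < n) v i = 0 -> forall i, (i < n)%N -> v i = 0;
  graded_act : forall i j a x, Agr i a -> Mgr j x -> Mgr (i + j)%N (a *: x)
}.

Definition generated_in_degree0 : Prop :=
  forall x, exists2 t : seq (A * M), (forall u, u \in t -> Mgr 0%N u.2) &
    x = \sum_(u <- t) u.1 *: u.2.

Definition one_dimensional (V : M -> Prop) : Prop :=
  exists e, [/\ V e, e != 0 & forall x, V x -> exists c : k, x = c%:A *: e].

Definition point_module : Prop :=
  [/\ graded_module, generated_in_degree0 & forall i, one_dimensional (Mgr i)].

End GradedModule.

Section FreeAlgebra.
Variables (k : fieldType) (n : nat).

(* Free associative algebra on n generators: the algebra of the free
   (noncommutative) monoid of words in 'I_n. *)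
Definition freealg := {malg k[{fmonom 'I_n}]}.

HB.instance Definition _ := GRing.Lalgebra.on freealg.

Lemma freealg_scaleAr (c : k) (f g : freealg) : c *: (f * g) = f * (c *: g).
Proof.
apply/malgP => w; rewrite [LHS]mcoeffZ [X in _ * X]mcoeffMl.
rewrite (mcoeffMlw (d1 := msupp f) (d2 := msupp g)) ?fsubset_refl ?msuppZ_le //.
rewrite mulr_sumr; apply: eq_bigr => u _; rewrite mulr_sumr.
by apply: eq_bigr => v _; rewrite mcoeffZ mulrnAr mulrCA.
Qed.

HB.instance Definition _ :=
  GRing.Lalgebra_isAlgebra.Build k freealg freealg_scaleAr.

Definition freegen (i : 'I_n) : freealg := mkmalgU (fmu i) 1.

(* Linear combinations of words of length d. *)
Definition free_grading (d : nat) (f : freealg) : Prop :=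
  forall w : {fmonom 'I_n}, mcoeff w f != 0 -> fdeg w = d.

(* Augmentation, used only to see that the ideals below are proper. *)
Definition free_aug (f : freealg) : k := mcoeff (@mone {fmonom 'I_n}) f.

HB.instance Definition _ := GRing.RMorphism.copy free_aug
  (mcoeff (@mone {fmonom 'I_n}) : freealg -> k).

Lemma free_aug_gen i : free_aug (freegen i) = 0.
Proof.
rewrite /free_aug mcoeffU1; case: eqP => // /(congr1 (@fdeg _)).
by rewrite fdegU fdeg1.
Qed.

End FreeAlgebra.

Section Relators.
Variables (k : fieldType) (A : algType k) (x_ : 'I_4 -> A).

Definition cyclic_relators (a : k) (i j l : 'I_4) : seq A :=
  [:: x_ 0 * x_ i - x_ i * x_ 0 - a *: (x_ j * x_ l - x_ l * x_ j);
      x_ 0 * x_ i + x_ i * x_ 0 - (x_ j * x_ l + x_ l * x_ j)].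

Lemma cyclic_relators_ker (B : nzRingType) (f : {rmorphism A -> B}) a i j l r :
  (forall i, f (x_ i) = 0) -> r \in cyclic_relators a i j l -> f r = 0.
Proof.
move=> fx; have fM i1 i2 : f (x_ i1 * x_ i2) = 0 by rewrite rmorphM fx mul0r.
have fZ c i1 i2 : f (c *: (x_ i1 * x_ i2)) = 0.
  by rewrite -mulr_algl rmorphM fM mulr0.
rewrite !inE => /orP[] /eqP ->; rewrite ?scalerBr;
  by rewrite !(raddfB, raddfD) /= !(fM, fZ) !(oppr0, addr0).
Qed.

End Relators.

Section Qtilde.
Variables (k : fieldType) (a1 a2 a3 : k).

Local Notation x_ := (@freegen k 4).

Definition Qt_relators : seq (freealg k 4) :=
  cyclic_relators x_ a1 1 2 3 ++ cyclic_relators x_ a2 2 3 1 ++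
  cyclic_relators x_ a3 3 1 2.

Lemma free_aug_relators f : f \in Qt_relators -> free_aug f = 0.
Proof.
rewrite !mem_cat => /or3P[]; apply: cyclic_relators_ker; exact: free_aug_gen.
Qed.

Lemma Qt_proper : ~ ideal_gen (fun f => f \in Qt_relators) 1.
Proof.
move=> /(@ideal_gen_ker _ _ _ _ (@free_aug k 4)) -/(_ free_aug_relators).
by rewrite rmorph1 => /eqP; rewrite oner_eq0.
Qed.

Definition Qt : algType k := algquot Qt_proper.

Definition Qt_grading : nat -> Qt -> Prop :=
  quot_grading (@free_grading k 4).

Definition Qt_gen (i : 'I_4) : Qt := algpi Qt_proper (x_ i).
Local Notation y_ := Qt_gen.

Definition Theta : Qt := y_ 0 ^+ 2 + y_ 1 ^+ 2 + y_ 2 ^+ 2 + y_ 3 ^+ 2.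

Definition Theta' : Qt :=
  y_ 1 ^+ 2 + ((1 + a1) / (1 - a2)) *: y_ 2 ^+ 2
            + ((1 - a1) / (1 + a3)) *: y_ 3 ^+ 2.

Lemma Bt_proper : ~ ideal_gen (fun u => u \in [:: Theta; Theta']) 1.
Proof.
have [g gE] := algquot_fact Qt_proper free_aug_relators.
have gy i : g (y_ i) = 0 by rewrite gE /= free_aug_gen.
have gZ c i : g (c *: y_ i ^+ 2) = 0.
  by rewrite -mulr_algl rmorphM rmorphXn gy expr0n mulr0.
have gX i : g (y_ i ^+ 2) = 0 by rewrite rmorphXn gy expr0n.
have gS u : u \in [:: Theta; Theta'] -> g u = 0.
  by rewrite !inE => /orP[] /eqP ->; rewrite !raddfD /= !(gX, gZ) !addr0.
move=> /(ideal_gen_ker gS) /eqP; by rewrite rmorph1 oner_eq0.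
Qed.

Definition Bt : algType k := algquot Bt_proper.

Definition Bt_grading : nat -> Bt -> Prop := quot_grading Qt_grading.

End Qtilde.

(* Main.v *)
(* The entries of a point module on three consecutive basis vectors give nonzero
   [p] and [q] in [k^4] with [y_i y_j] acting as [q_i p_j]. So the six relations
   and [Theta] become seven bilinear equations in [(p, q)], and it suffices that
   they have no nonzero solution.

   For [(i, j, l)] cyclic put [s_i = q_j p_l + q_l p_j], [t_i = q_j p_l - q_l p_j]
   and [d_a = q_a p_a]. The relations rewrite every off-diagonal [q_a p_b] in terms
   of the [s_i], [t_i], and the 2x2 minors of the rank one matrix [(q_a p_b)] become
   relations among [s_i], [t_i], [d_a]. They force [s_i t_i = 0] for all [i]; in
   each of the resulting cases the trace condition [sum d_a = 0] kills everything. *)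
Require Import Defs.
From HB Require Import structures.
From mathcomp Require Import all_boot all_order all_algebra.
From mathcomp Require Import monalg boolp.
From mathcomp Require Import ring.

Set Implicit Arguments.
Unset Strict Implicit.
Unset Printing Implicit Defensive.

Import GRing.Theory.
Local Open Scope ring_scope.

(** * The seven bilinear equations in [(p, q)] *)

Section PointScheme.
Variables (k : fieldType) (two_neq0 : 2 != 0 :> k).

Lemma double_eq0 (x : k) : 2 * x = 0 -> x = 0.
Proof. by move/eqP; rewrite mulf_eq0 (negbTE two_neq0) => /eqP. Qed.

(* If [d0 != 0], the hypotheses force [d2 = - a2 d1] and [d3 = a3 d1], and the trace
   condition turns into [(1 - a2) (1 + a3) d1^2 = 0]. *)
Lemma mixed_case_eq0 (a1 a2 a3 s1 s2 s3 t1 t2 t3 d0 d1 d2 d3 : k) :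
  a2 != 0 -> a3 != 0 -> 1 - a2 != 0 -> 1 + a3 != 0 -> d0 + d1 + d2 + d3 = 0 ->
  s1 ^+ 2 - t1 ^+ 2 = 4 * d2 * d3 -> s1 ^+ 2 - a1 ^+ 2 * t1 ^+ 2 = 4 * d0 * d1 ->
  s2 ^+ 2 - a2 ^+ 2 * t2 ^+ 2 = 4 * d0 * d2 ->
  s3 ^+ 2 - a3 ^+ 2 * t3 ^+ 2 = 4 * d0 * d3 ->
  s2 ^+ 2 + a2 * t2 ^+ 2 = s1 ^+ 2 - a1 * t1 ^+ 2 ->
  s1 ^+ 2 + a1 * t1 ^+ 2 = s3 ^+ 2 - a3 * t3 ^+ 2 ->
  t1 = 0 -> s2 = 0 -> s3 = 0 -> [/\ s1 = 0, t2 = 0 & t3 = 0].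
Proof.
move=> a2n0 a3n0 a2n a3n sum0 + + + + + + t10 s20 s30.
rewrite t10 s20 s30 expr0n /= !mulr0 !subr0 !sub0r !add0r addr0.
move=> S1 S1' T2' T3' E2 E3'.
have E3 : a3 * t3 ^+ 2 = - s1 ^+ 2 by rewrite E3' opprK.
suff s10 : s1 = 0.
  move: E2 E3; rewrite s10 expr0n oppr0 /= => /eqP + /eqP.
  rewrite !(mulf_eq0 _ (_ ^+ _)) !sqrf_eq0 (negbTE a2n0) (negbTE a3n0).
  by move=> /eqP -> /eqP ->.
have four x : 4 * x = 0 -> x = 0 :> k.
  by move=> x0; do 2!apply: double_eq0; rewrite -x0; ring.
suff: d0 * d1 = 0.
  by move=> d01; apply/eqP; rewrite -sqrf_eq0 S1' -mulrA d01 mulr0.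
have H2 : d0 * (d2 + a2 * d1) = 0.
  apply: four; rewrite !mulrDr.
  have -> : 4 * (d0 * d2) = 4 * d0 * d2 by ring.
  have -> : 4 * (d0 * (a2 * d1)) = a2 * (4 * d0 * d1) by ring.
  by rewrite -T2' -S1' -E2; ring.
have H3 : d0 * (d3 - a3 * d1) = 0.
  apply: four; rewrite !mulrBr.
  have -> : 4 * (d0 * d3) = 4 * d0 * d3 by ring.
  have -> : 4 * (d0 * (a3 * d1)) = a3 * (4 * d0 * d1) by ring.
  by rewrite -T3' -S1' -[s1 ^+ 2]opprK -E3; ring.
have [->|d0n] := eqVneq d0 0; first by rewrite mul0r.
have {}H2 : d2 = - a2 * d1.
  by move/eqP: H2; rewrite mulf_eq0 (negbTE d0n) addr_eq0 mulNr => /eqP.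
have {}H3 : d3 = a3 * d1.
  by move/eqP: H3; rewrite mulf_eq0 (negbTE d0n) subr_eq0 => /eqP.
have H0 : d0 = - (d1 + d2 + d3) by apply/eqP; rewrite -addr_eq0 !addrA sum0.
suff: (1 - a2) * (1 + a3) * d1 ^+ 2 = 0.
  move/eqP; rewrite mulf_eq0 mulf_eq0 (negbTE a2n) (negbTE a3n) sqrf_eq0 => /eqP ->.
  by rewrite mulr0.
apply: four.
have -> : 4 * ((1 - a2) * (1 + a3) * d1 ^+ 2) = 4 * d2 * d3 - 4 * d0 * d1.
  by rewrite H0 H2 H3; ring.
by rewrite -S1 -S1' subrr.
Qed.

(** The three equations chain around the cycle: [a1 t1^2 = s3^2 = s2^2 = - a1 t1^2]. *)
Lemma single_case_eq0 (a1 a2 a3 s1 s2 s3 t1 t2 t3 : k) :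
  a1 != 0 ->
  s1 ^+ 2 + a1 * t1 ^+ 2 = s3 ^+ 2 - a3 * t3 ^+ 2 ->
  s3 ^+ 2 + a3 * t3 ^+ 2 = s2 ^+ 2 - a2 * t2 ^+ 2 ->
  s2 ^+ 2 + a2 * t2 ^+ 2 = s1 ^+ 2 - a1 * t1 ^+ 2 ->
  s1 = 0 -> t2 = 0 -> t3 = 0 -> t1 = 0.
Proof.
move=> a1n + + + s10 t20 t30.
rewrite s10 t20 t30 expr0n /= !mulr0 !subr0 !addr0 add0r sub0r => E1 E3 E2.
have: 2 * (a1 * t1 ^+ 2) = 0 by rewrite mulr_natl mulr2n {1}E1 E3 E2 addNr.
by move/double_eq0/eqP; rewrite mulf_eq0 (negbTE a1n) sqrf_eq0 => /eqP.
Qed.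

(** If [s1 != 0], then no [s_i] vanishes, and for each [i] the two minors with left sides
    [2 d_i s_i] and [2 d0 s_i] give [d_i = d0]. The trace becomes [4 d0 = 0], so
    [s1^2 = 4 d0 d1 = 0]. *)
Lemma pure_case_eq0 (s1 s2 s3 d0 d1 d2 d3 : k) :
  d0 + d1 + d2 + d3 = 0 ->
  s1 ^+ 2 = s2 ^+ 2 -> s1 ^+ 2 = s3 ^+ 2 -> s1 ^+ 2 = 4 * d0 * d1 ->
  2 * d0 * s3 = s1 * s2 -> 2 * d1 * s1 = s2 * s3 -> 2 * d2 * s2 = s1 * s3 ->
  2 * d3 * s3 = s1 * s2 -> 2 * d0 * s2 = s1 * s3 -> 2 * d0 * s1 = s2 * s3 ->
  s1 = 0.
Proof.
move=> sum0 S12 S13 S1 E0 E1 E2 E3 E02 E01.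
apply/eqP/negPn/negP => s1n.
have s2n : s2 != 0 by rewrite -sqrf_eq0 -S12 sqrf_eq0.
have s3n : s3 != 0 by rewrite -sqrf_eq0 -S13 sqrf_eq0.
have eqd (s x y : k) : s != 0 -> 2 * x * s = 2 * y * s -> x = y.
  by move=> sn /(mulIf sn) /(mulfI two_neq0).
have d1E : d1 = d0 by apply: (eqd s1); rewrite // E1 E01.
have d2E : d2 = d0 by apply: (eqd s2); rewrite // E2 E02.
have d3E : d3 = d0 by apply: (eqd s3); rewrite // E3 E0.
have d00 : d0 = 0.
  by do 2!apply: double_eq0; rewrite -sum0 d1E d2E d3E; ring.
by move/eqP: S1; rewrite d00 mulr0 mul0r sqrf_eq0 (negbTE s1n).
Qed.

Section Solve.
Variables (a1 a2 a3 : k) (p0 p1 p2 p3 q0 q1 q2 q3 : k).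
Hypotheses (a_rel : a1 + a2 + a3 + a1 * a2 * a3 = 0).
Hypotheses (a1_gen : a1 \notin [:: 0; 1; -1]) (a2_gen : a2 \notin [:: 0; 1; -1])
  (a3_gen : a3 \notin [:: 0; 1; -1]).

Let s1 := q2 * p3 + q3 * p2.
Let t1 := q2 * p3 - q3 * p2.
Let s2 := q3 * p1 + q1 * p3.
Let t2 := q3 * p1 - q1 * p3.
Let s3 := q1 * p2 + q2 * p1.
Let t3 := q1 * p2 - q2 * p1.

Hypotheses (C1 : q0 * p1 - q1 * p0 = a1 * t1) (D1 : q0 * p1 + q1 * p0 = s1).
Hypotheses (C2 : q0 * p2 - q2 * p0 = a2 * t2) (D2 : q0 * p2 + q2 * p0 = s2).
Hypotheses (C3 : q0 * p3 - q3 * p0 = a3 * t3) (D3 : q0 * p3 + q3 * p0 = s3).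
Hypothesis sum0 : q0 * p0 + q1 * p1 + q2 * p2 + q3 * p3 = 0.

Let genP (a : k) : a \notin [:: 0; 1; -1] ->
  [/\ a != 0, 1 - a != 0 & 1 + a != 0].
Proof.
rewrite !inE !negb_or => /and3P[an an1 anN1]; split=> //.
  by rewrite subr_eq0 eq_sym.
by rewrite addrC addr_eq0.
Qed.

Lemma st_eq0 : [/\ s1 * t1 = 0, s2 * t2 = 0 & s3 * t3 = 0].
Proof.
have [_ b1 c1] := genP a1_gen; have [_ b2 c2] := genP a2_gen.
have [_ b3 c3] := genP a3_gen.
(* Both sides equal [2 (q0 q2 p1 p3 - q1 q3 p0 p2)] once each product contains one factor from the
   pair [{0, i}], by [C] or [D], and one from the opposite pair. [E3] and [E2] are its cyclic
   analogues. *)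
have E1 : (1 + a1) * (s1 * t1) = (a3 - 1) * (s3 * t3).
  have -> : (1 + a1) * (s1 * t1) = s1 * t1 + s1 * (a1 * t1) by ring.
  have -> : (a3 - 1) * (s3 * t3) = s3 * (a3 * t3) - s3 * t3 by ring.
  by rewrite -C1 -C3 -{1}D1 -{2}D3 /s1 /t1 /s3 /t3; ring.
have E3 : (1 + a3) * (s3 * t3) = (a2 - 1) * (s2 * t2).
  have -> : (1 + a3) * (s3 * t3) = s3 * t3 + s3 * (a3 * t3) by ring.
  have -> : (a2 - 1) * (s2 * t2) = s2 * (a2 * t2) - s2 * t2 by ring.
  by rewrite -C3 -C2 -{1}D3 -{2}D2 /s2 /t2 /s3 /t3; ring.
have E2 : (1 + a2) * (s2 * t2) = (a1 - 1) * (s1 * t1).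
  have -> : (1 + a2) * (s2 * t2) = s2 * t2 + s2 * (a2 * t2) by ring.
  have -> : (a1 - 1) * (s1 * t1) = s1 * (a1 * t1) - s1 * t1 by ring.
  by rewrite -C2 -C1 -{1}D2 -{2}D1 /s2 /t2 /s1 /t1; ring.
(* Going once around the cycle multiplies [s1 * t1] by
   [\prod (a_i - 1) / \prod (1 + a_i)], which is [-1] by [a_rel]. *)
have st1 : s1 * t1 = 0.
  have: 2 * ((1 + a1) * (1 + a2) * (1 + a3) * (s1 * t1)) = 0.
    have cyc : (1 + a1) * (1 + a2) * (1 + a3) * (s1 * t1) =
           (a1 - 1) * (a2 - 1) * (a3 - 1) * (s1 * t1).
      transitivity ((1 + a2) * (1 + a3) * ((1 + a1) * (s1 * t1))); first by ring.
      rewrite E1.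
      transitivity ((1 + a2) * (a3 - 1) * ((1 + a3) * (s3 * t3))); first by ring.
      rewrite E3.
      transitivity ((a2 - 1) * (a3 - 1) * ((1 + a2) * (s2 * t2))); first by ring.
      by rewrite E2; ring.
    rewrite mulr_natl mulr2n {1}cyc.
    transitivity (2 * (a1 + a2 + a3 + a1 * a2 * a3) * (s1 * t1)); first by ring.
    by rewrite a_rel mulr0 mul0r.
  by move/double_eq0/eqP; rewrite mulf_eq0 !(mulf_eq0 (_ * _) (1 + _))
    (mulf_eq0 (1 + _)) (negbTE c1) (negbTE c2) (negbTE c3) => /eqP.
have st2 : s2 * t2 = 0.
  by move/eqP: E2; rewrite st1 mulr0 mulf_eq0 (negbTE c2) => /eqP.
split=> //; by move/eqP: E3; rewrite st2 mulr0 mulf_eq0 (negbTE c3) => /eqP.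
Qed.

(** Each of the eight ways to have [s_i t_i = 0] for all [i] is first brought to [t1 = t2 = t3 = 0],
    which [pure] then settles. Cyclic rotation of the indices leaves four types of cases. *)
Lemma s_t_eq0 : [/\ s1 = 0, s2 = 0 & s3 = 0] /\ [/\ t1 = 0, t2 = 0 & t3 = 0].
Proof.
have [n1 b1 c1] := genP a1_gen; have [n2 b2 c2] := genP a2_gen.
have [n3 b3 c3] := genP a3_gen.
(* The [F] and [G] equations are the principal minors [(q_a p_b) (q_b p_a) = d_a d_b], without and
   with index 0. *)
have F1 : s1 ^+ 2 - t1 ^+ 2 = 4 * (q2 * p2) * (q3 * p3) by rewrite /s1 /t1; ring.
have F2 : s2 ^+ 2 - t2 ^+ 2 = 4 * (q3 * p3) * (q1 * p1) by rewrite /s2 /t2; ring.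
have F3 : s3 ^+ 2 - t3 ^+ 2 = 4 * (q1 * p1) * (q2 * p2) by rewrite /s3 /t3; ring.
have G1 : s1 ^+ 2 - a1 ^+ 2 * t1 ^+ 2 = 4 * (q0 * p0) * (q1 * p1).
  by rewrite -exprMn -C1 -D1; ring.
have G2 : s2 ^+ 2 - a2 ^+ 2 * t2 ^+ 2 = 4 * (q0 * p0) * (q2 * p2).
  by rewrite -exprMn -C2 -D2; ring.
have G3 : s3 ^+ 2 - a3 ^+ 2 * t3 ^+ 2 = 4 * (q0 * p0) * (q3 * p3).
  by rewrite -exprMn -C3 -D3; ring.
(* Both sides equal [2 (q0 q2 p1 p3 + q1 q3 p0 p2)], the companion with a plus sign of the identity
   behind [s_i t_i = 0]. *)
have H1 : s1 ^+ 2 + a1 * t1 ^+ 2 = s3 ^+ 2 - a3 * t3 ^+ 2.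
  rewrite !expr2 !(mulrA _ t1) !(mulrA _ t3) -C1 -C3 -{1}D1 -{1}D3.
  by rewrite /s1 /t1 /s3 /t3; ring.
have H3 : s3 ^+ 2 + a3 * t3 ^+ 2 = s2 ^+ 2 - a2 * t2 ^+ 2.
  rewrite !expr2 !(mulrA _ t2) !(mulrA _ t3) -C2 -C3 -{1}D2 -{1}D3.
  by rewrite /s2 /t2 /s3 /t3; ring.
have H2 : s2 ^+ 2 + a2 * t2 ^+ 2 = s1 ^+ 2 - a1 * t1 ^+ 2.
  rewrite !expr2 !(mulrA _ t1) !(mulrA _ t2) -C1 -C2 -{1}D1 -{1}D2.
  by rewrite /s1 /t1 /s2 /t2; ring.
have pure : t1 = 0 -> t2 = 0 -> t3 = 0 ->
    [/\ s1 = 0, s2 = 0 & s3 = 0] /\ [/\ t1 = 0, t2 = 0 & t3 = 0].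
  move=> t10 t20 t30.
  move: H1 H2 G1; rewrite t10 t20 t30 expr0n /= !mulr0 !addr0 !subr0.
  move=> S13 S21 S1.
  (* The matrix [(q_a p_b)] is now symmetric, so [s_i] is twice [q_j p_l] and also twice [q0 p_i];
     the hypotheses of [pure_case_eq0] are then its minors. *)
  move: (C1) (C2) (C3); rewrite t10 t20 t30 !mulr0.
  move=> /subr0_eq K1 /subr0_eq K2 /subr0_eq K3.
  have L1 := subr0_eq t10; have L2 := subr0_eq t20; have L3 := subr0_eq t30.
  have e1 : s1 = 2 * (q2 * p3) by rewrite /s1 -L1; ring.
  have e2 : s2 = 2 * (q3 * p1) by rewrite /s2 -L2; ring.
  have e3 : s3 = 2 * (q1 * p2) by rewrite /s3 -L3; ring.
  have f1 : s1 = 2 * (q0 * p1) by rewrite -D1 -K1; ring.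
  have f2 : s2 = 2 * (q0 * p2) by rewrite -D2 -K2; ring.
  have f3 : s3 = 2 * (q0 * p3) by rewrite -D3 -K3; ring.
  have s10 : s1 = 0.
    apply: (pure_case_eq0 sum0 (esym S21) S13 S1).
    - by rewrite e3 f2 f1 K1; ring.
    - by rewrite e1 e2 L2 e3 L3; ring.
    - by rewrite e2 L2 e1 e3; ring.
    - by rewrite e3 L3 e1 e2; ring.
    - by rewrite e2 f3 f1 K3; ring.
    - by rewrite e1 f2 f3 K2; ring.
  move: S13 S21; rewrite s10 expr0n /= => /esym/eqP + /eqP.
  by rewrite !sqrf_eq0 => /eqP -> /eqP ->.
have [/eqP + /eqP + /eqP] := st_eq0; rewrite !mulf_eq0.
have sum2 : q0 * p0 + q2 * p2 + q3 * p3 + q1 * p1 = 0 by rewrite -sum0; ring.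
have sum3 : q0 * p0 + q3 * p3 + q1 * p1 + q2 * p2 = 0 by rewrite -sum0; ring.
have mixed1 := mixed_case_eq0 n2 n3 b2 c3 sum0 F1 G1 G2 G3 H2 H1.
have mixed2 := mixed_case_eq0 n3 n1 b3 c1 sum2 F2 G2 G3 G1 H3 H2.
have mixed3 := mixed_case_eq0 n1 n2 b1 c2 sum3 F3 G3 G1 G2 H1 H3.
case/orP=> /eqP z1; case/orP=> /eqP z2; case/orP=> /eqP z3.
(* With all [s_i = 0], each step around the cycle flips the sign of [a_i t_i^2]; three flips give
   [a1 t1^2 = - a1 t1^2]. *)
- have t10 : t1 = 0.
    move: H1 H3 H2; rewrite z1 z2 z3 expr0n /= !add0r => E1 E3 E2.
    have: 2 * (a1 * t1 ^+ 2) = 0 by rewrite mulr_natl mulr2n {1}E1 E3 E2 opprK addNr.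
    by move/double_eq0/eqP; rewrite mulf_eq0 (negbTE n1) sqrf_eq0 => /eqP.
  by have [_ t20 t30] := mixed1 t10 z2 z3; exact: pure.
- by have [_ t10 t20] := mixed3 z3 z1 z2; exact: pure.
- by have [_ t30 t10] := mixed2 z2 z3 z1; exact: pure.
- by apply: pure => //; exact: single_case_eq0 n1 H1 H3 H2 z1 z2 z3.
- by have [_ t20 t30] := mixed1 z1 z2 z3; exact: pure.
- by apply: pure => //; exact: single_case_eq0 n2 H2 H1 H3 z2 z3 z1.
- by apply: pure => //; exact: single_case_eq0 n3 H3 H2 H1 z3 z1 z2.
- exact: pure.
Qed.

(** The products [q_a p_b] are the Segre coordinates of [(q, p)]. Off the diagonal they vanish
    because their half sums and half differences do; the trace handles the diagonal. *)
Lemma segre_point_eq0 x y :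
  x \in [:: q0; q1; q2; q3] -> y \in [:: p0; p1; p2; p3] -> x * y = 0.
Proof.
have [[s10 s20 s30] [t10 t20 t30]] := s_t_eq0.
have half u v : u + v = 0 -> u - v = 0 -> u = 0 /\ v = 0 :> k.
  move=> uv0 /subr0_eq uv; suff v0 : v = 0 by rewrite uv v0.
  by apply: double_eq0; rewrite -uv0 uv; ring.
have [q23 q32] := half _ _ s10 t10.
have [q31 q13] := half _ _ s20 t20.
have [q12 q21] := half _ _ s30 t30.
move: (D1) (D2) (D3) (C1) (C2) (C3).
rewrite s10 s20 s30 t10 t20 t30 !mulr0 => E1 E2 E3 E1' E2' E3'.
have [q01 q10] := half _ _ E1 E1'.
have [q02 q20] := half _ _ E2 E2'.
have [q03 q30] := half _ _ E3 E3'.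
(* Multiplying the trace by [d_a] leaves only [d_a^2], since [d_a d_b = (q_a p_b) (q_b p_a) = 0] for
   [b != a]. *)
have sq0 (u v : k) : u * v * (q0 * p0 + q1 * p1 + q2 * p2 + q3 * p3) = (u * v) ^+ 2
    -> u * v = 0.
  by rewrite sum0 mulr0 => /esym/eqP; rewrite sqrf_eq0 => /eqP.
have q00 : q0 * p0 = 0.
  apply: sq0; transitivity ((q0 * p0) ^+ 2 + (q0 * p1) * (q1 * p0) +
    (q0 * p2) * (q2 * p0) + (q0 * p3) * (q3 * p0)); first by ring.
  by rewrite q01 q02 q03; ring.
have q11 : q1 * p1 = 0.
  apply: sq0; transitivity ((q1 * p1) ^+ 2 + (q1 * p0) * (q0 * p1) +
    (q1 * p2) * (q2 * p1) + (q1 * p3) * (q3 * p1)); first by ring.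
  by rewrite q10 q12 q13; ring.
have q22 : q2 * p2 = 0.
  apply: sq0; transitivity ((q2 * p2) ^+ 2 + (q2 * p0) * (q0 * p2) +
    (q2 * p1) * (q1 * p2) + (q2 * p3) * (q3 * p2)); first by ring.
  by rewrite q20 q21 q23; ring.
have q33 : q3 * p3 = 0 by move: sum0; rewrite q00 q11 q22 !add0r.
by rewrite !inE => /or4P[] /eqP -> /or4P[] /eqP ->.
Qed.
End Solve.
End PointScheme.

(** * Generation of an algebra by given elements *)

(* Equivalent to [y] generating [A] as a [k]-algebra once [y] consists of
   elements of positive degree. *)
Definition augmented_by (k : fieldType) (A : algType k) n (y : 'I_n -> A) :=
  forall b : A, exists c : k, exists g : 'I_n -> A,
    b = c%:A + \sum_i g i * y i.

Lemma freegen_augmented (k : fieldType) n : augmented_by (@freegen k n).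
Proof.
move=> f; rewrite (monalgE f).
apply: (big_ind (fun b : freealg k n => exists c : k, exists g : 'I_n -> freealg k n,
  b = c%:A + \sum_i g i * freegen k i)).
- exists 0, (fun=> 0); rewrite scale0r add0r big1 // => i _.
  by rewrite mul0r.
- move=> _ _ [c [g ->]] [c' [g' ->]]; exists (c + c'), (fun i => g i + g' i).
  under [in RHS]eq_bigr do rewrite mulrDl.
  by rewrite big_split scalerDl addrACA.
(* The empty word gives the constant; any other word has its last letter split off as the right
   factor. *)
move=> w _; case: w => s; case: (lastP s) => [|s' i].
  exists f@_(FMonom [::]), (fun=> 0).
  rewrite big1 => [|i _]; last by rewrite mul0r.
  rewrite addr0 -fmoneE; apply/malgP => w.
  by rewrite mcoeffU [RHS]mcoeffZ mcoeffU1 mulr_natr.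
set c := f@__; exists 0, (fun j => if j == i then << c *g FMonom s' >> else 0).
rewrite scale0r add0r (bigD1 i) //= eqxx big1 => [|j /negbTE ->]; last by rewrite mul0r.
rewrite addr0 [RHS]malgM_def fgmulUU mulr1; congr (mkmalgU _ _).
by apply/eqP; rewrite fmP fmM fmU /= cats1.
Qed.

Lemma algpi_augmented (k : fieldType) (A : algType k) (S : A -> Prop)
    (S1 : ~ ideal_gen S 1) n (y : 'I_n -> A) :
  augmented_by y -> augmented_by (fun i => algpi S1 (y i)).
Proof.
move=> augy u; have [c [g gE]] := augy (alglift u).
exists c, (fun i => algpi S1 (g i)).
rewrite -(algliftK u) gE rmorphD rmorph_sum /= linearZ /= rmorph1.
by congr (_ + _); apply: eq_bigr => i _; rewrite rmorphM.
Qed.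

(** * Coordinates of a point module in degrees 0, 1, 2 *)

Section PointModule.
Variables (k : fieldType) (A : algType k) (Agr : nat -> A -> Prop).
Variables (M : lmodType A) (Mgr : nat -> M -> Prop).
Variables (n : nat) (y : 'I_n -> A).
Hypotheses (augy : augmented_by y) (y_deg1 : forall i, Agr 1%N (y i)).

Lemma alg_scale_comm (c : k) (a : A) (m : M) : a *: (c%:A *: m) = c%:A *: (a *: m).
Proof. by rewrite !scalerA mulr_algl mulr_algr. Qed.

Lemma alg_scale_eq0 (c : k) (m : M) : m != 0 -> c%:A *: m = 0 -> c = 0.
Proof.
move=> mn cm0; apply/eqP/negPn/negP => cn; case/eqP: mn.
by rewrite -[m]scale1r -[1](scale1r) -(mulVf cn) -scalerA -mulr_algl -scalerA cm0 scaler0.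
Qed.

(** With [e_d] spanning degree [d], [p] and [q] are defined by [y_i e0 = p_i e1] and
    [y_i e1 = q_i e2]. Were [p] or [q] zero, [A e0] could not reach [e1] or [e2], although [e0]
    generates [M]. *)
Lemma point_module_coordinates : point_module Agr Mgr ->
  exists (e0 e2 : M) (p q : 'I_n -> k), [/\ e2 != 0, exists i, p i != 0,
    exists i, q i != 0 & forall i j, (y i * y j) *: e0 = (q i * p j)%:A *: e2].
Proof.
case=> gM gen0 dim1.
have [e0 [M0 n0 s0]] := dim1 0%N; have [e1 [M1 n1 s1]] := dim1 1%N.
have [e2 [M2 n2 s2]] := dim1 2%N.
have grZ i c x : Mgr i x -> Mgr i (c%:A *: x).
  move=> Mx; rewrite -[_ *: x]addr0.
  by apply: (graded_subD gM) => //; exact: (graded_sub0 gM).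
have grN i x : Mgr i x -> Mgr i (- x) by move/(grZ i (- 1)); rewrite !scaleN1r.
have /choice[p pE] i : exists c : k, y i *: e0 = c%:A *: e1.
  by apply: s1; apply: (graded_act gM (y_deg1 i) M0).
have /choice[q qE] i : exists c : k, y i *: e1 = c%:A *: e2.
  by apply: s2; apply: (graded_act gM (y_deg1 i) M1).
have cyc x : exists b : A, x = b *: e0.
  have [t tM ->] := gen0 x; rewrite big_seq.
  apply: (big_ind (fun x => exists b : A, x = b *: e0)).
  - by exists 0; rewrite scale0r.
  - by move=> _ _ [b ->] [b' ->]; exists (b + b'); rewrite scalerDl.
  move=> u /tM /s0[c ->]; exists (u.1 * c%:A); by rewrite scalerA.
have direct (v : nat -> M) : (forall i, Mgr i (v i)) -> forall m, \sum_(i < m) v i = 0 ->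
    forall i, (i < m)%N -> v i = 0 by move=> vM m; apply: (graded_direct gM vM).
exists e0, e2, p, q; split=> //.
- apply: contrapT => /forallNP p0; case/eqP: n1.
  have [b] := cyc e1; have [c [g ->]] := augy b.
  rewrite scalerDl scaler_suml big1 => [|i _]; last first.
    have /negP/negPn/eqP pi0 := p0 i.
    by rewrite -scalerA pE pi0 !scale0r scaler0.
  rewrite addr0 => e1E.
  (* The relation [c e0 - e1 = 0] as a sum of homogeneous terms: directness forces [e1 = 0]. *)
  pose v i : M := if i is 0%N then c%:A *: e0 else if i is 1%N then - e1 else 0.
  have vM i : Mgr i (v i).
    by case: i => [|[|i]] /=; [exact: grZ|exact: grN|exact: (graded_sub0 gM)].
  have /direct := vM; move=> /(_ 2%N); rewrite !big_ord_recr big_ord0 /= add0r -e1E subrr.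
  by move=> /(_ erefl 1%N isT) /= /eqP; rewrite oppr_eq0 => /eqP.
- apply: contrapT => /forallNP q0; case/eqP: n2.
  (* If [q = 0], every [y_i] kills [e1], so [A] acts on [e1] by scalars and [A e0] lies in the span
     of [e0] and [e1]. *)
  have act1 b : exists c : k, b *: e1 = c%:A *: e1.
    have [c [g ->]] := augy b; exists c.
    rewrite scalerDl scaler_suml big1 => [|i _]; first by rewrite addr0.
    have /negP/negPn/eqP qi0 := q0 i.
    by rewrite -scalerA qE qi0 !scale0r scaler0.
  have [b] := cyc e2; have [c [g ->]] := augy b.
  have [d dE] : exists d : k, (\sum_i g i * y i) *: e0 = d%:A *: e1.
    rewrite scaler_suml; apply: (big_ind (fun x => exists d : k, x = d%:A *: e1)).
    - by exists 0; rewrite !scale0r.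
    - by move=> _ _ [d ->] [d' ->]; exists (d + d'); rewrite !scalerDl.
    move=> i _; have [d dE] := act1 (g i); exists (p i * d).
    by rewrite -scalerA pE alg_scale_comm dE scalerA mulr_algl scalerA.
  rewrite scalerDl dE => e2E.
  pose v i : M := match i with 0%N => c%:A *: e0 | 1%N => d%:A *: e1 | 2%N => - e2
    | _ => 0 end.
  have vM i : Mgr i (v i).
    by case: i => [|[|[|i]]] /=;
      [exact: grZ|exact: grZ|exact: grN|exact: (graded_sub0 gM)].
  have /direct := vM; move=> /(_ 3%N); rewrite !big_ord_recr big_ord0 /= add0r -e2E subrr.
  by move=> /(_ erefl 2%N isT) /= /eqP; rewrite oppr_eq0 => /eqP.
move=> i j; rewrite -scalerA pE alg_scale_comm qE.
by rewrite scalerA mulr_algl scalerA mulrC.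
Qed.

End PointModule.

(** * Application to [Qt] and [Bt] *)

Section NoPointModule.
Variables (k : fieldType) (two_neq0 : 2 != 0 :> k) (a1 a2 a3 : k).
Hypotheses (a_rel : a1 + a2 + a3 + a1 * a2 * a3 = 0).
Hypotheses (a1_gen : a1 \notin [:: 0; 1; -1]) (a2_gen : a2 \notin [:: 0; 1; -1])
  (a3_gen : a3 \notin [:: 0; 1; -1]).

(** Evaluation at an arbitrary quadruple lets the relators be carried along algebra morphisms. *)
Definition Qt_relators_at (A : algType k) (y : 'I_4 -> A) : seq A :=
  cyclic_relators y a1 1 2 3 ++ cyclic_relators y a2 2 3 1 ++
  cyclic_relators y a3 3 1 2.

(** Stated for any algebra generated by a solution of the relations, so as to cover both [Qt] acting
    on a module killed by [Theta] and [Bt], where the image of [Theta] is zero. *)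
Lemma no_point_module (A : algType k) (Agr : nat -> A -> Prop)
    (M : lmodType A) (Mgr : nat -> M -> Prop) (y : 'I_4 -> A) :
  augmented_by y -> (forall i, Agr 1%N (y i)) ->
  {in Qt_relators_at y, forall r, r = 0} ->
  (forall m : M, (y 0 ^+ 2 + y 1 ^+ 2 + y 2 ^+ 2 + y 3 ^+ 2) *: m = 0) ->
  ~ point_module Agr Mgr.
Proof.
move=> augy y1 rel0 trace0 /(point_module_coordinates augy y1).
move=> [e0 [e2 [p [q [e2n [j pj] [i qi] yyE]]]]].
have comE a i1 i2 i3 : {subset cyclic_relators y a i1 i2 i3 <= Qt_relators_at y} ->
    q 0 * p i1 - q i1 * p 0 = a * (q i2 * p i3 - q i3 * p i2) /\
    q 0 * p i1 + q i1 * p 0 = q i2 * p i3 + q i3 * p i2.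
  (* Each relator is applied to [e0] and the coefficient of [e2] is read off: the head is the
     commutator relation, the last the anticommutator one. *)
  move=> sub; split; apply: subr0_eq; apply: (alg_scale_eq0 e2n).
    have /rel0/(congr1 (fun r => r *: e0)) := sub _ (mem_head _ _).
    rewrite scale0r -(mulr_algl a) !(scalerBl, mulrBr) -!(scalerA a%:A) !yyE.
    by rewrite !scalerA !mulr_algl !scalerA.
  have /rel0/(congr1 (fun r => r *: e0)) := sub _ (mem_last _ _).
  by rewrite scale0r !(scalerBl, scalerDl) !yyE.
have [|C1 D1] := comE a1 1 2 3; first by move=> r; rewrite !mem_cat => ->.
have [|C2 D2] := comE a2 2 3 1; first by move=> r; rewrite !mem_cat => ->; rewrite orbT.
have [|C3 D3] := comE a3 3 1 2; first by move=> r; rewrite !mem_cat => ->; rewrite !orbT.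
have sum0 : q 0 * p 0 + q 1 * p 1 + q 2 * p 2 + q 3 * p 3 = 0.
  apply: (alg_scale_eq0 e2n); move: (trace0 e0).
  by rewrite !expr2 !scalerDl !yyE.
have ord4 (f : 'I_4 -> k) (l : 'I_4) : f l \in [:: f 0; f 1; f 2; f 3].
  rewrite !inE; case: l => [[|[|[|[|//]]]]] lt_l; apply/or4P.
  - by apply: Or41; apply/eqP; congr f; apply: val_inj.
  - by apply: Or42; apply/eqP; congr f; apply: val_inj.
  - by apply: Or43; apply/eqP; congr f; apply: val_inj.
  - by apply: Or44; apply/eqP; congr f; apply: val_inj.
have := segre_point_eq0 two_neq0 a_rel a1_gen a2_gen a3_gen C1 D1 C2 D2 C3 D3 sum0
  (ord4 q i) (ord4 p j).
by move/eqP; rewrite mulf_eq0 (negbTE qi) (negbTE pj).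
Qed.

Lemma freegen_deg1 n (i : 'I_n) : free_grading 1 (freegen k i).
Proof.
move=> w; rewrite mcoeffU1; have [<-|_] := eqVneq (fmu i) w.
  by rewrite fdegU.
by rewrite eqxx.
Qed.

Lemma map_cyclic_relators (A B : algType k) (f : {lrmorphism A -> B}) (y : 'I_4 -> A)
    a i j l :
  cyclic_relators (f \o y) a i j l = map f (cyclic_relators y a i j l).
Proof. by rewrite /= !rmorphB !rmorphD /= linearZ /= rmorphB /= !rmorphM. Qed.

Lemma map_Qt_relators_at (A B : algType k) (f : {lrmorphism A -> B}) (y : 'I_4 -> A) :
  Qt_relators_at (f \o y) = map f (Qt_relators_at y).
Proof. by rewrite /Qt_relators_at !map_cyclic_relators !map_cat. Qed.

Lemma Qt_gen_relators : {in Qt_relators_at (Qt_gen a1 a2 a3), forall r, r = 0}.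
Proof.
move=> r; rewrite (map_Qt_relators_at (algpi (@Qt_proper k a1 a2 a3))).
by move=> /mapP[f fR ->]; apply/algpi0P; exact: ideal_gen_in.
Qed.

Lemma Qt_gen_augmented : augmented_by (Qt_gen a1 a2 a3).
Proof. exact/algpi_augmented/freegen_augmented. Qed.

Lemma Qt_gen_deg1 i : Qt_grading 1 (Qt_gen a1 a2 a3 i).
Proof. by exists (freegen k i) => //; exact: freegen_deg1. Qed.

End NoPointModule.

Theorem proposition9p5 (k : closedFieldType) (char_neq2 : 2%N \notin [pchar k])
    (a1 a2 a3 : k) (a_rel : a1 + a2 + a3 + a1 * a2 * a3 = 0)
    (a1_gen : a1 \notin [:: 0; 1; -1]) (a2_gen : a2 \notin [:: 0; 1; -1])
    (a3_gen : a3 \notin [:: 0; 1; -1]) :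
  (forall (M : lmodType (Qt a1 a2 a3)) (Mgr : nat -> M -> Prop),
      point_module (@Qt_grading k a1 a2 a3) Mgr ->
      ~ (forall m : M, Theta a1 a2 a3 *: m = 0))
  /\
  (forall (M : lmodType (Bt a1 a2 a3)) (Mgr : nat -> M -> Prop),
      ~ point_module (@Bt_grading k a1 a2 a3) Mgr).
Proof.
have two_neq0 : 2 != 0 :> k by move: char_neq2; rewrite inE.
split=> M Mgr.
  move=> pM Theta0.
  exact: (no_point_module two_neq0 a_rel a1_gen a2_gen a3_gen
    (@Qt_gen_augmented _ a1 a2 a3) (@Qt_gen_deg1 _ a1 a2 a3)
    (@Qt_gen_relators _ a1 a2 a3) Theta0 pM).
(* [Bt] is treated directly through the images of the generators, without restricting modules along
   [pi]. *)
pose pi : {lrmorphism Qt a1 a2 a3 -> Bt a1 a2 a3} := algpi (@Bt_proper k a1 a2 a3).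
apply: (no_point_module two_neq0 a_rel a1_gen a2_gen a3_gen
  (y := pi \o Qt_gen a1 a2 a3)).
- exact/algpi_augmented/Qt_gen_augmented.
- by move=> i; exists (Qt_gen a1 a2 a3 i) => //; exact: Qt_gen_deg1.
- move=> r; rewrite map_Qt_relators_at => /mapP[u uR ->].
  by rewrite (Qt_gen_relators uR) raddf0.
move=> m; rewrite [X in X *: m](_ : _ = pi (Theta a1 a2 a3)); last first.
  by rewrite !rmorphD !rmorphXn.
rewrite [pi _](_ : _ = 0) ?scale0r //.
by apply/algpi0P; apply: ideal_gen_in; rewrite mem_head.
Qed.
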